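(* The coding function $\mathfrak{C}\colon\mathcal{E}\to\mathbb{M}$, $h\mapsto\mathcal{T}_h=(T_h,d_h,\mu_h)$, is continuous with respect to the excursion metric $d_{\mathcal{E}}$ on $\mathcal{E}$ and the Gromov-Prohorov metric $d_{\mathrm{GP}}$ on $\mathbb{M}$.
   Context: A metric measure space (mm-space) is a triple $(X,d,\mu)$ where $(X,d)$ is a complete separable metric space and $\mu$ is a probability measure on the Borel $\sigma$-algebra of $X$. Two mm-spaces $(X,d,\mu)$ and $(X',d',\mu')$ are isomorphic (and are not distinguished) if there is a measure preserving map $f\colon X\to X'$ (i.e. $\mu'=\mu\circ f^{-1}$) with $d(x,y)=d'(f(x),f(y))$ for all $x,y\in\mathrm{supp}(\mu)$. $\mathbb{M}$ denotes the space of isomorphism classes of mm-spaces. Prohorov distance: for probability measures $\mu,\nu$ on a metric space $(X,d)$, $d_{\mathrm{Pr}}(\mu,\nu)=\inf\{\varepsilon>0 : \mu(A)\le \nu(A^\varepsilon)+\varepsilon \text{ for all Borel } A\subseteq X\}$, where $A^\varepsilon=\{x\in X: d(A,x)<\varepsilon\}$. Gromov-Prohorov metric: for mm-spaces $\mathcal{X}_i=(X_i,d_i,\mu_i)$, $i=1,2$, $d_{\mathrm{GP}}(\mathcal{X}_1,\mathcal{X}_2)=\inf_{f,g} d_{\mathrm{Pr}}(\mu_1\circ f^{-1},\mu_2\circ g^{-1})$, where the infimum is over all isometries (isometric embeddings) $f\colon X_1\to X$, $g\colon X_2\to X$ into a common separable metric space $(X,d)$. Excursions: $\mathcal{E}=\{h\colon[0,1]\to\mathbb{R}_+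 : h(0)=0,\ h \text{ lower semi-continuous}\}$, where $\mathbb{R}_+=[0,\infty)$. Excursion metric: let $\lambda$ be Lebesgue measure on $[0,1]$. For $h,h'\in\mathcal{E}$ let $d_\lambda(h,h')=\inf\{\varepsilon>0 : \lambda(\{t : |h(t)-h'(t)|>\varepsilon\})<\varepsilon\}$, and $d_\Gamma(h,h')=d_H(\mathrm{epi}(h),\mathrm{epi}(h'))$, where $\mathrm{epi}(h)=\{(t,y)\in[0,1]\times\mathbb{R}_+ : y\ge h(t)\}$ and $d_H$ is the Hausdorff metric for closed subsets of $\mathbb{R}^2$. Then $d_{\mathcal{E}}=d_\Gamma+d_\lambda$. Coded spaces: for $h\in\mathcal{E}$ and $s,t\in[0,1]$ let $I_h(s,t)=\inf_{u\in[s\wedge t,\,s\vee t]}h(u)$ and $d_h(s,t)=h(s)+h(t)-2I_h(s,t)$. This is a semi-metric (pseudo-metric) on $[0,1]$; let $T_h=[0,1]/d_h$ be the quotient metric space (identifying points at $d_h$-distance $0$), with metric again denoted $d_h$, and $\pi_h\colon[0,1]\to T_h$ the natural projection. For $h\in\mathcal{E}$, $T_h$ is separable and $\pi_h$ is measurable; $T_h$ is identified with its completion. Let $\mu_h=\lambda\circ\pi_h^{-1}$ be the image of Lebesgue measure under $\pi_h$. Then $\mathcal{T}_h=(T_h,d_h,\mu_h)$ is an mm-space. *)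

(* Defs.v *)
From HB Require Import structures.
From mathcomp Require Import all_boot all_order all_algebra.
From mathcomp Require Import all_classical all_reals all_analysis.
From mathcomp Require Import measurable_realfun ring lra.
Set Implicit Arguments.
Unset Strict Implicit.
Unset Printing Implicit Defensive.
Import Order.TTheory GRing.Theory Num.Theory.
Import numFieldNormedType.Exports.
Local Open Scope classical_set_scope.
Local Open Scope ring_scope.

(* MathComp-Analysis attaches sigma-algebras to pointed types, hence the base
   points below; they only express that the spaces are nonempty. *)
#[short(type="pmetricType")]
HB.structure Definition PointedMetric (R : realType) :=
  {T of Metric R T & isPointed T}.

#[short(type="completeMetricType")]
HB.structure Definition CompleteMetric (R : realType) :=
  {T of Metric R T & Complete T}.

Definition separable_space (T : topologicalType) : Prop :=
  exists2 D : set T, countable D & dense D.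

Definition borel (T : topologicalType) := g_sigma_algebraType (@open T).
HB.instance Definition _ (T : ptopologicalType) := Measurable.on (borel T).

Definition isometric (R : realType) (X Y : metricType R) (f : X -> Y) : Prop :=
  forall x y, mdist (f x) (f y) = mdist x y.

Record pseudometric (R : realType) (T : Type) := Pseudometric {
  pdist :> T -> T -> R ;
  pdistxx : forall x, pdist x x = 0 ;
  pdist_sym : forall x y, pdist x y = pdist y x ;
  pdist_triangle : forall y x z, pdist x z <= pdist x y + pdist y z }.

Section metric_quotient.
Context {R : realType} {T : pointedType} (d : pseudometric R T).

Let pdist_ge0 x y : 0 <= d x y.
Proof.
by have := pdist_triangle d y x x; rewrite pdistxx (pdist_sym d y x); lra.
Qed.

Definition pdist0 : rel T := [rel x y | d x y == 0].

Let pdist0_refl : reflexive pdist0.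
Proof. by move=> x; rewrite /pdist0/= pdistxx. Qed.
Let pdist0_sym : symmetric pdist0.
Proof. by move=> x y; rewrite /pdist0/= pdist_sym. Qed.
Let pdist0_trans : transitive pdist0.
Proof.
move=> y x z /eqP xy /eqP yz; apply/eqP/le_anti; rewrite pdist_ge0 andbT.
by rewrite (le_trans (pdist_triangle d y x z))// xy yz addr0.
Qed.

Canonical pdist0_equiv := EquivRel pdist0 pdist0_refl pdist0_sym pdist0_trans.

Definition mquot := {eq_quot pdist0}%qT.
HB.instance Definition _ := Quotient.on mquot.
HB.instance Definition _ := Choice.on mquot.

Definition mquot_pi (x : T) : mquot := \pi_mquot%qT x.
Definition mquot_dist (u v : mquot) : R := d (repr u) (repr v).

Let mquot_distxx u : mquot_dist u u = 0.
Proof. exact: pdistxx. Qed.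
Let mquot_dist_positivity u v : mquot_dist u v = 0 -> u = v.
Proof.
move=> /eqP uv; rewrite -[u]reprK -[v]reprK; exact/eqmodP.
Qed.
Let mquot_dist_sym u v : mquot_dist u v = mquot_dist v u.
Proof. exact: pdist_sym. Qed.
Let mquot_dist_triangle v u w :
  mquot_dist u w <= mquot_dist u v + mquot_dist v w.
Proof. exact: pdist_triangle. Qed.

HB.instance Definition _ := isMetric.Build R mquot
  mquot_distxx mquot_dist_positivity mquot_dist_sym mquot_dist_triangle.
HB.instance Definition _ := isPointed.Build mquot (mquot_pi point).

Lemma mdist_mquot_pi x y : mdist (mquot_pi x) (mquot_pi y) = d x y.
Proof.
have r0 z : d (repr (mquot_pi z)) z = 0.
  by apply/eqP; have /eqmodP := reprK (mquot_pi z).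
have r0' z : d z (repr (mquot_pi z)) = 0 by rewrite pdist_sym.
have := pdist_triangle d x (repr (mquot_pi x)) (repr (mquot_pi y)).
have := pdist_triangle d y x (repr (mquot_pi y)).
have := pdist_triangle d (repr (mquot_pi x)) x y.
have := pdist_triangle d (repr (mquot_pi y)) (repr (mquot_pi x)) y.
have -> : mdist (mquot_pi x) (mquot_pi y) =
  d (repr (mquot_pi x)) (repr (mquot_pi y)) by [].
rewrite !r0 !r0'.
by move=> *; apply/le_anti/andP; split; lra.
Qed.

Lemma mquot_piK u : exists x, u = mquot_pi x.
Proof. by exists (repr u); rewrite /mquot_pi reprK. Qed.
End metric_quotient.

(* The point z of the completion of T is encoded by the function
   x |-> d(x, z) on T: these functions are exactly those that satisfy
   |f x - f y| <= d(x, y) <= f x + f y and inf f = 0.  The lemmas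
   to_completion_isometric, dense_to_completion and completion_complete are the
   defining properties of a completion. *)
Section completion.
Context {R : realType} (T : pmetricType R).

Definition is_dist_fun (f : T -> R) :=
  [/\ forall x y, `|f x - f y| <= mdist x y,
      forall x y, mdist x y <= f x + f y & inf (range f) = 0].

Record completion := Completion {
  dist_fun :> T -> R ; dist_funP : is_dist_fun dist_fun }.

HB.instance Definition _ := gen_eqMixin completion.
HB.instance Definition _ := gen_choiceMixin completion.

Definition completion_dist (f g : completion) : R :=
  inf [set f x + g x | x in [set: T]].

Lemma dist_fun_ge0 (f : completion) x : 0 <= f x.
Proof.
have [_ /(_ x x) + _] := dist_funP f.
by rewrite mdistxx; lra.
Qed.

Lemma dist_fun_lip (f : completion) x y : f x <= f y + mdist x y.
Proof.
have [/(_ x y) + _ _] := dist_funP f.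
by rewrite ler_norml => /andP[_]; lra.
Qed.

Lemma dist_fun_triangle (f : completion) x y : mdist x y <= f x + f y.
Proof. by have [_ + _] := dist_funP f. Qed.

Lemma dist_fun_small (f : completion) e : 0 < e -> exists x, f x < e.
Proof.
move=> e0; have [_ _ f0] := dist_funP f.
have /(inf_adherent e0)[_ [x _ <-]] : has_inf (range f).
  split; first by exists (f point), point.
  by exists 0 => _ [x _ <-]; exact: dist_fun_ge0.
by rewrite f0 add0r; exists x.
Qed.

Lemma has_inf_completion_dist (f g : completion) :
  has_inf [set f x + g x | x in [set: T]].
Proof.
split; first by exists (f point + g point), point.
by exists 0 => _ [x _ <-]; rewrite addr_ge0// dist_fun_ge0.
Qed.

Lemma completion_dist_le (f g : completion) x :
  completion_dist f g <= f x + g x.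
Proof.
by apply: ge_inf; [exact: (has_inf_completion_dist f g).2|exists x].
Qed.

Lemma completion_dist_adh (f g : completion) e : 0 < e ->
  exists x, f x + g x < completion_dist f g + e.
Proof.
move=> e0; have [_ [x _ <-] ?] :=
  inf_adherent e0 (has_inf_completion_dist f g).
by exists x.
Qed.

Lemma completion_dist_fun (f g : completion) x :
  f x <= g x + completion_dist f g.
Proof.
apply/ler_addgt0Pr => e e0.
have [z zfg] := completion_dist_adh f g e0.
have := dist_fun_lip f x z; have := dist_fun_triangle g x z; lra.
Qed.

Let completion_distC f g : completion_dist f g = completion_dist g f.
Proof.
by rewrite /completion_dist; congr inf; apply/seteqP; split=> _ [x _ <-];
  exists x => //; rewrite addrC.
Qed.

Let completion_dist_ge0 f g : 0 <= completion_dist f g.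
Proof.
apply: lb_le_inf; first exact: (has_inf_completion_dist f g).1.
by move=> _ [x _ <-]; rewrite addr_ge0// dist_fun_ge0.
Qed.

Let completion_distxx f : completion_dist f f = 0.
Proof.
apply/le_anti; rewrite completion_dist_ge0 andbT.
apply/ler_addgt0Pr => e e0; rewrite add0r.
have [x fx] : exists x, f x < e / 2 by apply: dist_fun_small; rewrite divr_gt0.
by have := completion_dist_le f f x; lra.
Qed.

Let completion_dist_positivity f g : completion_dist f g = 0 -> f = g.
Proof.
move=> fg0; have fgE : dist_fun f = dist_fun g.
  apply/funext => x; apply/le_anti.
  have := completion_dist_fun f g x.
  by have := completion_dist_fun g f x; rewrite (completion_distC g) fg0; lra.
case: f g fgE {fg0} => f Pf [g Pg] /= fgE; subst g.
by congr Completion; exact: Prop_irrelevance.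
Qed.

Let completion_dist_triangle g f k :
  completion_dist f k <= completion_dist f g + completion_dist g k.
Proof.
apply/ler_addgt0Pr => e e0.
have [x fgx] := completion_dist_adh f g e0.
have := completion_dist_le f k x.
by have := completion_dist_fun k g x; rewrite (completion_distC k); lra.
Qed.

HB.instance Definition _ := isMetric.Build R completion completion_distxx
  completion_dist_positivity completion_distC completion_dist_triangle.

Lemma mdist_is_dist_fun z : is_dist_fun (mdist z).
Proof.
split=> [x y|x y|].
- have := metric_triangle z x y; have := metric_triangle z y x.
  by rewrite (metric_sym y x) ler_norml => *; apply/andP; split; lra.
- by rewrite (le_trans (metric_triangle _ z _))// (metric_sym x).
- apply/le_anti/andP; split.
    apply: ge_inf; last by exists z => //; rewrite mdistxx.
    by exists 0 => _ [x _ <-]; exact: mdist_ge0.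
  apply: lb_le_inf; first by exists (mdist z z), z.
  by move=> _ [x _ <-]; exact: mdist_ge0.
Qed.

Definition to_completion (z : T) : completion :=
  Completion (mdist_is_dist_fun z).

HB.instance Definition _ := isPointed.Build completion (to_completion point).

Lemma mdist_to_completion z (f : completion) : mdist (to_completion z) f = f z.
Proof.
apply/le_anti/andP; split.
  by have := completion_dist_le (to_completion z) f z; rewrite /= mdistxx add0r.
apply/ler_addgt0Pr => e e0.
have [x] := completion_dist_adh (to_completion z) f e0.
have := dist_fun_lip f z x; rewrite /= /mdist/=; lra.
Qed.

Lemma to_completion_isometric : isometric to_completion.
Proof. by move=> x y; rewrite mdist_to_completion/= metric_sym. Qed.

Lemma dense_to_completion (D : set T) :
  dense D -> dense (to_completion @` D).
Proof.
move=> dD O [f Of] oO.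
have /nbhs_ballP[e /= e0 fO] := open_nbhs_nbhs (conj oO Of).
have [x fx] : exists x, f x < e / 2 by apply: dist_fun_small; rewrite divr_gt0.
have e20 : 0 < e / 2 by rewrite divr_gt0.
have [y [xy Dy]] : (ball x (e / 2))° `&` D !=set0.
  apply: dD; last exact: open_interior.
  by exists x; apply: nbhs_singleton; apply: nbhs_interior; exact: nbhsx_ballx.
exists (to_completion y); split; last by exists y.
apply: fO; rewrite ballEmdist/= metric_sym mdist_to_completion.
have := nbhs_singleton xy; rewrite ballEmdist/= => {}xy.
by have := dist_fun_lip f y x; rewrite (metric_sym y); lra.
Qed.

Lemma completion_separable : separable_space T -> separable_space completion.
Proof.
move=> [D cD dD]; exists (to_completion @` D); last exact: dense_to_completion.
exact: card_le_trans (card_image_le _ _) cD.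
Qed.

Lemma mdist_completionE (f g : completion) : mdist f g = completion_dist f g.
Proof. by []. Qed.

Lemma mdist_completion_ler (f g : completion) x : `|f x - g x| <= mdist f g.
Proof.
have := completion_dist_fun f g x; have := completion_dist_fun g f x.
rewrite -!mdist_completionE (metric_sym g) ler_norml => *.
by apply/andP; split; lra.
Qed.

Lemma completion_complete (F : set_system completion) :
  ProperFilter F -> cauchy F -> cvg F.
Proof.
move=> FF Fc.
have close e : 0 < e -> exists f : completion, F (ball f e).
  by move=> e0; move/cauchyP : Fc; apply.
pose ev x := fun g : completion => g x.
have cev x : cvg (ev x @ F).
  apply/cauchy_cvgP/cauchy_exP => e /close[f Ff]; exists (f x).
  apply: (@filterS _ F _ _ _ _ Ff) => g; rewrite ballEmdist/= => fg; rewrite /ball/=.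
  exact: le_lt_trans (mdist_completion_ler _ _ _) fg.
pose phi x := lim (ev x @ F).
have phif e (f : completion) x : F (ball f e) -> `|phi x - f x| <= e.
  move=> Ff; rewrite ler_distl; apply/andP; split.
    apply: limr_ge => //; apply: (@filterS _ F _ _ _ _ Ff) => g; rewrite ballEmdist/= => fg.
    have := mdist_completion_ler f g x; rewrite ler_norml /ev => /andP[_]; lra.
  apply: limr_le => //; apply: (@filterS _ F _ _ _ _ Ff) => g; rewrite ballEmdist/= => fg.
  have := mdist_completion_ler f g x; rewrite ler_norml /ev => /andP[+ _]; lra.
have phi_ge0 x : 0 <= phi x.
  by apply: limr_ge => //; apply: nearW => g; exact: dist_fun_ge0.
have phi_dist : is_dist_fun phi.
  split=> [x y|x y|].
  - apply/ler_addgt0Pr => e e0; have [f Ff] := close (e / 2) ltac:(lra).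
    have [+ _ _] := dist_funP f => /(_ x y).
    have := phif _ _ x Ff; have := phif _ _ y Ff.
    rewrite !ler_norml => /andP[? ?] /andP[? ?] /andP[? ?].
    by apply/andP; split; lra.
  - apply/ler_addgt0Pr => e e0; have [f Ff] := close (e / 2) ltac:(lra).
    have [_ + _] := dist_funP f => /(_ x y).
    have := phif _ _ x Ff; have := phif _ _ y Ff.
    by rewrite !ler_norml => /andP[? ?] /andP[? ?]; lra.
  - have ne : range phi !=set0 by exists (phi point), point.
    have lb : lbound (range phi) 0 by move=> _ [x _ <-].
    apply/le_anti/andP; split; last exact: lb_le_inf.
    apply/ler_addgt0Pr => e e0; rewrite add0r.
    have [f Ff] := close (e / 2) ltac:(lra).
    have [x fx] := dist_fun_small f (ltac:(lra) : 0 < e / 2).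
    have := phif _ _ x Ff; rewrite ler_norml => /andP[_ ?].
    have : inf (range phi) <= phi x by apply: ge_inf; [exists 0|exists x].
    by lra.
apply/cvg_ex; exists (Completion phi_dist); apply/fcvg_ballP => e e0.
have [f Ff] := close (e / 4) ltac:(lra).
apply: (@filterS _ F _ _ _ _ Ff) => g; rewrite !ballEmdist/= => fg.
have [x fx] := dist_fun_small f (ltac:(lra) : 0 < e / 4).
have := completion_dist_le (Completion phi_dist) g x.
have := phif _ _ x Ff; have := mdist_completion_ler f g x.
rewrite -mdist_completionE !ler_norml /=.
by move=> /andP[? ?] /andP[? ?] ?; lra.
Qed.
HB.instance Definition _ := Uniform_isComplete.Build completion
  completion_complete.
End completion.

Section unit_interval.
Context {R : realType}.

Definition unitI : Type := set_type (`[0, 1]%classic : set R).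
HB.instance Definition _ := Choice.on unitI.
HB.instance Definition _ := Topological.copy unitI (set_type (`[0, 1]%classic : set R)).

Definition unitI_val (t : unitI) : R := set_val t.

Lemma unitI_val_itv t : 0 <= unitI_val t <= 1.
Proof. by have := set_valP t; rewrite /= in_itv. Qed.

Let unitI0_subproof : (0 : R) \in (`[0, 1]%classic : set R).
Proof. by rewrite inE /= in_itv /= lexx ler01. Qed.
Definition unitI0 : unitI := exist _ 0 unitI0_subproof.
HB.instance Definition _ := isPointed.Build unitI unitI0.

Lemma unitI_val_inj : injective unitI_val.
Proof. exact: val_inj. Qed.

Lemma unitI_val_continuous : continuous unitI_val.
Proof. exact: initial_continuous. Qed.

Definition lebesgue01 (A : set (borel unitI)) : \bar R :=
  lebesgue_measure (unitI_val @` A).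

Lemma measurable_borelE : (@measurable _ (measurableTypeR R)) = <<s @open R >>.
Proof.
apply/seteqP; split=> [A|].
  rewrite RGenOpens.measurableE; apply: sub_sigma_algebra2 => _ [a [b ->]].
  exact: interval_open.
apply: smallest_sub; first exact: sigma_algebra_measurable.
by move=> U; exact: open_measurable.
Qed.

Lemma borel_unitIP (A : set (borel unitI)) : measurable A ->
  exists2 B : set (measurableTypeR R), measurable B & A = unitI_val @^-1` B.
Proof.
rewrite /measurable/= => mA.
have : preimage_set_system setT unitI_val (@open R).-sigma.-measurable A.
  rewrite -g_sigma_preimageE; apply: sub_sigma_algebra2 mA => U [V oV <-].
  by exists V => //; rewrite setTI.
move=> [B mB <-]; exists B; last by rewrite setTI.
by have : <<s @open R >> B := mB; rewrite -measurable_borelE.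
Qed.

Lemma measurable_unitI_val : measurable_fun [set: borel unitI]
  (unitI_val : borel unitI -> measurableTypeR R).
Proof.
apply: (measurability (@open R)); first exact: measurable_borelE.
move=> _ [U oU <-]; apply: sub_sigma_algebra; rewrite setTI.
by move/continuousP : unitI_val_continuous; apply.
Qed.

Lemma image_unitI_val (B : set R) :
  unitI_val @` (unitI_val @^-1` B) = B `&` `[0, 1].
Proof.
apply/seteqP; split=> [_ [t Bt <-]|x [Bx x01]].
  by split => //; rewrite /= in_itv/= unitI_val_itv.
by exists (exist _ x (mem_set x01)).
Qed.

Lemma measurable_image_unitI_val (A : set (borel unitI)) :
  measurable A -> measurable (unitI_val @` A : set (measurableTypeR R)).
Proof.
by move=> /borel_unitIP[B mB ->]; rewrite image_unitI_val; exact: measurableI.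
Qed.

Let lebesgue01_0 : lebesgue01 set0 = 0%E.
Proof. by rewrite /lebesgue01 image_set0 measure0. Qed.

Let lebesgue01_ge0 A : (0 <= lebesgue01 A)%E.
Proof. exact: measure_ge0. Qed.

Let lebesgue01_sigma_additive : semi_sigma_additive lebesgue01.
Proof.
move=> F mF tF mUF; rewrite /lebesgue01 image_bigcup.
apply: measure_semi_sigma_additive.
- by move=> n; exact: measurable_image_unitI_val.
- apply/trivIsetP => i j _ _ ij; apply/seteqP; split => // x [[s Fs <-] [t Ft]].
  move/unitI_val_inj => ts; move/trivIsetP : tF => /(_ i j I I ij).
  by move=> /seteqP[+ _] => /(_ s); apply; split => //; rewrite -ts.
- by rewrite -image_bigcup; exact: measurable_image_unitI_val.
Qed.

HB.instance Definition _ := isMeasure.Build _ _ _ lebesgue01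
  lebesgue01_0 lebesgue01_ge0 lebesgue01_sigma_additive.

Let lebesgue01_setT : lebesgue01 [set: borel unitI] = 1%E.
Proof.
rewrite /lebesgue01 -(preimage_setT unitI_val) image_unitI_val setTI.
by rewrite lebesgue_measure_itv/= lte_fin ltr01 oppr0 adde0.
Qed.

HB.instance Definition _ :=
  Measure_isProbability.Build _ _ _ lebesgue01 lebesgue01_setT.

End unit_interval.
Arguments unitI : clear implicits.

Record excursion (R : realType) := Excursion {
  exc_fun :> unitI R -> R ;
  exc_ge0 : forall t, 0 <= exc_fun t ;
  exc_at0 : exc_fun unitI0 = 0 ;
  exc_lsc : lower_semicontinuous (EFin \o exc_fun) }.

Lemma open_bigcup_ball (R : realType) (T : metricType R) (D U : set T) :
  dense D -> open U ->
  U = \bigcup_(i in [set i : T * nat | D i.1 /\ ball i.1 i.2.+1%:R^-1 `<=` U])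
        (ball i.1 (i.2.+1%:R^-1 : R)).
Proof.
move=> dD oU; apply/seteqP; split=> [x Ux|x [[c n] /= [_ +]]]; last exact.
have /nbhs_ballP[e /= e0 eU] := open_nbhs_nbhs (conj oU Ux).
have [n] : exists n : nat, n.+1%:R^-1 < e / 2 :> R.
  have /ltr_add_invr[n] : 0 < e / 2 by lra.
  by rewrite add0r; exists n.
have : 0 < n.+1%:R^-1 :> R by rewrite invr_gt0.
set r : R := n.+1%:R^-1 => r0 re.
have [c [xc Dc]] : (ball x r)^° `&` D !=set0.
  apply: dD; last exact: open_interior.
  by exists x; apply: nbhs_singleton; apply: nbhs_interior; exact: nbhsx_ballx.
have {}xc := nbhs_singleton xc.
exists (c, n) => /=; last exact: ball_sym.
split=> // y cy; apply: eU; apply: le_ball (ball_triangle xc cy).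
by rewrite -/r; lra.
Qed.

Lemma countable_bigcup_measurable d (T : measurableType d) (I : Type)
    (P : set I) (F : I -> set T) : countable P ->
  (forall i, P i -> measurable (F i)) -> measurable (\bigcup_(i in P) F i).
Proof.
move=> cP mF; rewrite bigcup_set_type; apply: countable_bigcupT_measurable.
  by rewrite (eq_countable (card_setT P)).
by move=> i; apply: mF; exact: set_valP.
Qed.

Section coded_metric.
Context {R : realType} (h : excursion R).
Implicit Types s t u v : unitI R.

Definition between s t : set (unitI R) :=
  [set u | Num.min (unitI_val s) (unitI_val t) <= unitI_val u
           <= Num.max (unitI_val s) (unitI_val t)].

Definition exc_inf s t : R := inf (h @` between s t).

Definition exc_dist s t : R := h s + h t - 2 * exc_inf s t.

Lemma betweenC s t : between s t = between t s.
Proof. by rewrite /between minC maxC. Qed.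

Lemma exc_inf_le s t u : between s t u -> exc_inf s t <= h u.
Proof.
move=> stu; apply: ge_inf; last by exists u.
by exists 0 => _ [v _ <-]; exact: exc_ge0.
Qed.

Lemma between_left s t : between s t s.
Proof. by rewrite /between/= ge_min le_max !lexx. Qed.

Lemma between_right s t : between s t t.
Proof. by rewrite betweenC; exact: between_left. Qed.

Lemma exc_inf_ge s t a :
  (forall u, between s t u -> a <= h u) -> a <= exc_inf s t.
Proof.
move=> ah; apply: lb_le_inf; first by exists (h s), s => //; exact: between_left.
by move=> _ [u /ah ? <-].
Qed.

Lemma exc_infC s t : exc_inf s t = exc_inf t s.
Proof. by rewrite /exc_inf betweenC. Qed.

Lemma exc_inf_sub s t u v : between s t `<=` between u v ->
  exc_inf u v <= exc_inf s t.
Proof. by move=> sub; apply: exc_inf_ge => w /sub; exact: exc_inf_le. Qed.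

Lemma between_split s t u : between s u `<=` between s t `|` between t u.
Proof.
move=> v; rewrite /between/= !ge_min !le_max => /andP[/orP[] a /orP[] b];
  have [c|/ltW c] := leP (unitI_val t) (unitI_val v);
  by [left; rewrite ?a ?b ?c ?orbT|right; rewrite ?a ?b ?c ?orbT].
Qed.

Let exc_distxx t : exc_dist t t = 0.
Proof.
have : exc_inf t t = h t.
  apply/le_anti/andP; split; first exact/exc_inf_le/between_left.
  apply: exc_inf_ge => u; rewrite /between/= minxx maxxx => /le_anti.
  by move=> /unitI_val_inj ->.
by rewrite /exc_dist => ->; lra.
Qed.

Let exc_distC s t : exc_dist s t = exc_dist t s.
Proof. by rewrite /exc_dist exc_infC (addrC (h s)). Qed.

Let exc_dist_triangle t s u : exc_dist s u <= exc_dist s t + exc_dist t u.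
Proof.
have st : exc_inf s t <= h t by exact/exc_inf_le/between_right.
have tu : exc_inf t u <= h t by exact/exc_inf_le/between_left.
have : Num.min (exc_inf s t) (exc_inf t u) <= exc_inf s u.
  apply: exc_inf_ge => v /(@between_split s t u)[] /exc_inf_le vI.
    by rewrite ge_min vI.
  by rewrite ge_min vI orbT.
by rewrite ge_min /exc_dist => /orP[] ?; lra.
Qed.

Definition exc_pseudometric : pseudometric R (unitI R) :=
  Pseudometric exc_distxx exc_distC exc_dist_triangle.

Definition coded_space := mquot exc_pseudometric.
HB.instance Definition _ := PointedMetric.on coded_space.

Definition coded_pi (t : unitI R) : coded_space := mquot_pi exc_pseudometric t.

Lemma mdist_coded_pi s t : mdist (coded_pi s) (coded_pi t) = exc_dist s t.
Proof. exact: mdist_mquot_pi. Qed.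

Let near_min (p q : rat) (n : nat) : set (unitI R) :=
  [set s | ratr p < unitI_val s < ratr q /\
    forall u, ratr p < unitI_val u < ratr q -> h s < h u + n.+1%:R^-1].

Let near_min_neq0 p q n t : ratr p < unitI_val t < ratr q ->
  near_min p q n !=set0.
Proof.
move=> ptq; pose A := h @` [set u | ratr p < unitI_val u < ratr q].
have iA : has_inf A.
  split; first by exists (h t), t.
  by exists 0 => _ [v _ <-]; exact: exc_ge0.
have n0 : 0 < n.+1%:R^-1 :> R by rewrite invr_gt0.
have [_ [s sI <-] sA] := inf_adherent n0 iA.
exists s; split=> // u uI; apply: lt_le_trans sA _.
by rewrite lerD2r; apply: ge_inf; [exact: iA.2|exists u].
Qed.

Let nbhs_unitI t (V : set (unitI R)) : nbhs t V -> exists p q : rat,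
  ratr p < unitI_val t < ratr q /\
  forall u, ratr p < unitI_val u < ratr q -> V u.
Proof.
move=> [_ [[W oW <-] /= Wt WV]].
have /nbhs_ballP[e /= e0 eW] := open_nbhs_nbhs (conj oW Wt).
have /rat_in_itvoo[p] : unitI_val t - e < unitI_val t by lra.
rewrite in_itv/= => /andP[ep pt].
have /rat_in_itvoo[q] : unitI_val t < unitI_val t + e by lra.
rewrite in_itv/= => /andP[tq qe].
exists p, q; split; first by rewrite pt.
move=> u /andP[pu uq]; apply: WV => /=; apply: eW.
suff : `|unitI_val t - unitI_val u| < e by [].
by rewrite ltr_distl; apply/andP; split; lra.
Qed.

Lemma coded_space_separable : separable_space coded_space.
Proof.
pose f (i : rat * rat * nat) : coded_space :=
  coded_pi (get (near_min i.1.1 i.1.2 i.2)).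
exists (range f); first exact: card_le_trans (card_image_le _ _) (countableP _).
move=> O [x Ox] oO; have [t xt] := mquot_piK x; subst x.
have /nbhs_ballP[e /= e0 eO] := open_nbhs_nbhs (conj oO Ox).
have [V] : exists2 V, nbhs t V & forall u, V u -> ((h t - e / 4)%:E < (h u)%:E)%E.
  by apply: exc_lsc; rewrite /= lte_fin; lra.
move=> /nbhs_unitI[p [q [ptq pqV]]] Vh.
have [n ne] : exists n : nat, n.+1%:R^-1 < e / 4 :> R.
  have /ltr_add_invr[n] : 0 < e / 4 by lra.
  by rewrite add0r; exists n.
have := getPex (near_min_neq0 n ptq); set s := get _ => -[psq smin].
exists (coded_pi s); split; last by exists (p, q, n).
apply: eO; rewrite ballEmdist/= [X in X < _](mdist_coded_pi t s).
have : h t - e / 4 <= exc_inf t s.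
  apply: exc_inf_ge => u; rewrite /between/= ge_min le_max => tus.
  have /pqV/Vh : ratr p < unitI_val u < ratr q.
    by move: ptq psq tus => /andP[? ?] /andP[? ?] /andP[/orP[]? /orP[]?];
      apply/andP; split; lra.
  by rewrite lte_fin => /ltW.
move: (smin t ptq) ne; rewrite /exc_dist; move: (n.+1%:R^-1) => r *; lra.
Qed.

Lemma measurable_exc : measurable_fun [set: borel (unitI R)]
  (h : borel (unitI R) -> measurableTypeR R).
Proof.
apply: (measurability (@RGenOInfty.G R)); first exact: RGenOInfty.measurableE.
move=> _ [_ [a ->] <-]; rewrite setTI.
rewrite (_ : _ @^-1` _ = [set t | (a%:E < (h t)%:E)%E]); last first.
  by apply/seteqP; split=> t /=; rewrite in_itv/= andbT lte_fin.
by apply: sub_sigma_algebra; move: a; apply/lower_semicontinuousP; exact: exc_lsc.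
Qed.

Lemma measurable_exc_inf s : measurable_fun [set: borel (unitI R)]
  (exc_inf s : borel (unitI R) -> measurableTypeR R).
Proof.
apply: (measurability (@RGenCInfty.G R)); first exact: RGenCInfty.measurableE.
move=> _ [_ [a ->] <-]; rewrite setTI.
pose A := unitI_val @` [set t | a <= exc_inf s t].
rewrite (_ : _ @^-1` _ = unitI_val @^-1` A); last first.
  apply/seteqP; split=> t /=; rewrite in_itv/= andbT; first by exists t.
  by move=> [u /= uI /unitI_val_inj <-].
rewrite -[X in measurable X]setTI.
apply: measurable_unitI_val => //; apply: is_interval_measurable.
move=> _ _ [t1 /= at1 <-] [t2 /= at2 <-] x /andP[t1x xt2].
have x01 : x \in (`[0, 1]%classic : set R).
  have /andP[? ?] := unitI_val_itv t1; have /andP[? ?] := unitI_val_itv t2.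
  by rewrite inE /= in_itv/=; apply/andP; split; lra.
pose t : unitI R := exist _ x x01.
have tE : unitI_val t = x by [].
exists t => //=; have [st|/ltW ts] := leP (unitI_val s) x.
  apply: le_trans at2 _; apply: exc_inf_sub => u.
  rewrite /between/= tE !ge_min !le_max => /andP[/orP[]a1 /orP[]a2];
    by apply/andP; split; apply/orP; (try by left; lra); right; lra.
apply: le_trans at1 _; apply: exc_inf_sub => u.
rewrite /between/= tE !ge_min !le_max => /andP[/orP[]a1 /orP[]a2];
  by apply/andP; split; apply/orP; (try by left; lra); right; lra.
Qed.

Lemma measurable_exc_dist s : measurable_fun [set: borel (unitI R)]
  (exc_dist s : borel (unitI R) -> measurableTypeR R).
Proof.
apply: measurable_funB.
  apply: measurable_funD; first exact: measurable_cst.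
  exact: measurable_exc.
apply: measurable_funM; first exact: measurable_cst.
exact: measurable_exc_inf.
Qed.

Definition coding_map (t : borel (unitI R)) : borel (completion coded_space) :=
  to_completion (coded_pi t).

Lemma measurable_coding_map : measurable_fun [set: borel (unitI R)] coding_map.
Proof.
have borelE : @measurable _ (borel (completion coded_space)) =
  <<s @open (completion coded_space) >> by [].
apply: (measurability _ borelE).
move=> _ [U oU <-]; rewrite setTI.
have [D cD dD] := coded_space_separable.
have cD' : countable (@to_completion R coded_space @` D).
  exact: card_le_trans (card_image_le _ _) cD.
rewrite (open_bigcup_ball (dense_to_completion dD) oU) preimage_bigcup.
apply: countable_bigcup_measurable => [|[_ n] /= [[x Dx <-] _]].
  apply: (@sub_countable _ _ _ ((to_completion (T:=coded_space) @` D) `*` [set: nat])).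
    by apply: subset_card_le => -[c n] [/= Dc _].
  exact: countableX.
have [s ->] := mquot_piK x.
rewrite (_ : _ @^-1` _ = exc_dist s @^-1` `]-oo, n.+1%:R^-1[).
  rewrite -[X in measurable X]setTI; exact: measurable_exc_dist.
apply/seteqP; split=> t /=;
by rewrite in_itv/= ballEmdist/= to_completion_isometric [mdist _ _](mdist_coded_pi s t).
Qed.

HB.instance Definition _ :=
  isMeasurableFun.Build _ _ _ _ coding_map measurable_coding_map.

End coded_metric.

Record mmSpace (R : realType) := MMSpace {
  mm_space :> completeMetricType R ;
  mm_separable : separable_space mm_space ;
  mm_measure : probability (borel mm_space) R }.

Definition coded_mmSpace (R : realType) (h : excursion R) : mmSpace R :=
  MMSpace (completion_separable (coded_space_separable h))
          (distribution (@lebesgue01 R) (coding_map h)).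

Section set_distances.
Context {R : realType}.
Local Open Scope ereal_scope.

(* +oo if A is empty *)
Definition dist_to_set (T : Type) (d : T -> T -> R) (A : set T) (x : T) : \bar R :=
  ereal_inf [set (d a x)%:E | a in A].

Definition hausdorff_dist (T : Type) (d : T -> T -> R) (A B : set T) : \bar R :=
  maxe (ereal_sup [set dist_to_set d B a | a in A])
       (ereal_sup [set dist_to_set d A b | b in B]).

Definition enlargement (X : metricType R) (A : set X) (e : R) : set X :=
  [set x | dist_to_set mdist A x < e%:E].

Definition prohorov (X : pmetricType R) (mu nu : set (borel X) -> \bar R) :
    \bar R :=
  ereal_inf [set e%:E | e in [set e : R | (0 < e)%R /\
    forall A : set (borel X), measurable A ->
      mu A <= nu (enlargement A e) + e%:E]].
End set_distances.

Section excursion_metric.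
Context {R : realType}.
Implicit Types h : excursion R.

(* y >= 0 is implied by h >= 0 *)
Definition epi h : set (R * R) :=
  [set p | exists2 t : unitI R, unitI_val t = p.1 & h t <= p.2].

Definition euclid_dist (p q : R * R) : R :=
  Num.sqrt ((p.1 - q.1) ^+ 2 + (p.2 - q.2) ^+ 2).

Definition exc_dist_epi h h' : \bar R :=
  hausdorff_dist euclid_dist (epi h) (epi h').

Definition exc_dist_leb h h' : \bar R :=
  ereal_inf [set e%:E | e in [set e : R | 0 < e /\
    (lebesgue01 [set t : unitI R | e < `|h t - h' t|]%R < e%:E)%E]].

Definition exc_metric h h' : \bar R :=
  (exc_dist_epi h h' + exc_dist_leb h h')%E.
End excursion_metric.

Section mm_spaces.
Context {R : realType}.
Implicit Types X Y : mmSpace R.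

Definition mm_support X : set X :=
  [set x | forall U : set X, open U -> U x -> (0 < mm_measure X U)%E].

Definition mm_isomorphic X Y : Prop :=
  exists f : borel X -> borel Y,
    [/\ measurable_fun setT f,
        forall A : set (borel Y), measurable A ->
          mm_measure Y A = pushforward (mm_measure X) f A &
        forall x y : X, mm_support x -> mm_support y ->
          mdist (f x : Y) (f y : Y) = mdist x y].

Definition mm_gromov_prohorov X Y : \bar R :=
  ereal_inf [set r | exists Z : pmetricType R, exists f : X -> Z,
    exists g : Y -> Z, [/\ separable_space Z, isometric f, isometric g &
      r = prohorov
            (pushforward (mm_measure X) (f : borel X -> borel Z))
            (pushforward (mm_measure Y) (g : borel Y -> borel Z))]].

End mm_spaces.

(* A predicate rather than a set: the carrier of set _ is a small type. *)
Record mmClass (R : realType) := MMClass {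
  mm_member : mmSpace R -> Prop ;
  mm_memberP : exists X, mm_member = mm_isomorphic X }.

Definition mm_class (R : realType) (X : mmSpace R) : mmClass R :=
  MMClass (ex_intro _ X erefl).

(* All representatives give the same value: see gromov_prohorov_class. *)
Definition gromov_prohorov (R : realType) (C D : mmClass R) : \bar R :=
  ereal_inf [set r | exists X Y : mmSpace R,
    [/\ mm_member C X, mm_member D Y & r = mm_gromov_prohorov X Y]].

Definition coding (R : realType) (h : excursion R) : mmClass R :=
  mm_class (coded_mmSpace h).

Lemma mdist_closer (R : realType) (T : metricType R) (D : set T) (x : T) (e : R) :
  dense D -> 0 < e -> exists2 c, D c & mdist x c < e.
Proof.
move=> dD e0; have [c [xc Dc]] : (ball x e)^° `&` D !=set0.
  apply: dD; last exact: open_interior.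
  by exists x; apply: nbhs_singleton; apply: nbhs_interior; exact: nbhsx_ballx.
by exists c => //; have := nbhs_singleton xc; rewrite ballEmdist.
Qed.

Section gluing.
Context {R : realType} (X Z : pmetricType R) (S : set X) (phi : X -> Z).
Context (phi_isom : forall x y, S x -> S y -> mdist (phi x) (phi y) = mdist x y).
Context (S0 : S !=set0).

Definition glue := (X + Z)%type.
HB.instance Definition _ := Choice.on glue.
HB.instance Definition _ := isPointed.Build glue (inl point).

Let cross_set x z := [set mdist x s + mdist (phi s) z | s in S].
Let cross x z := inf (cross_set x z).

Let has_inf_cross x z : has_inf (cross_set x z).
Proof.
have [s Ss] := S0; split; first by exists (mdist x s + mdist (phi s) z), s.
by exists 0 => _ [t _ <-]; rewrite addr_ge0// mdist_ge0.
Qed.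

Let cross_le x z s : S s -> cross x z <= mdist x s + mdist (phi s) z.
Proof. by move=> Ss; apply: ge_inf; [exact: (has_inf_cross x z).2|exists s]. Qed.

Let cross_adh x z e : 0 < e ->
  exists2 s, S s & mdist x s + mdist (phi s) z < cross x z + e.
Proof.
by move=> e0; have [_ [s Ss <-] ?] := inf_adherent e0 (has_inf_cross x z); exists s.
Qed.

Definition glue_dist (u v : glue) : R :=
  match u, v with
  | inl x, inl y => mdist x y
  | inr z, inr w => mdist z w
  | inl x, inr z | inr z, inl x => cross x z
  end.

Let glue_distxx u : glue_dist u u = 0.
Proof. by case: u => x; exact: mdistxx. Qed.

Let glue_distC u v : glue_dist u v = glue_dist v u.
Proof. by case: u v => x [] y //=; exact: metric_sym. Qed.

Let cross_l x y z : cross x z <= mdist x y + cross y z.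
Proof.
apply/ler_addgt0Pr => e /(cross_adh y z)[s Ss se].
have := cross_le x z Ss; have := metric_triangle x y s; lra.
Qed.

Let cross_r x z w : cross x w <= cross x z + mdist z w.
Proof.
apply/ler_addgt0Pr => e /(cross_adh x z)[s Ss se].
have := cross_le x w Ss; have := metric_triangle (phi s) z w; lra.
Qed.

Let cross_lrl x y z : mdist x y <= cross x z + cross y z.
Proof.
apply/ler_addgt0Pr => e e0; have e20 : 0 < e / 2 by lra.
have [s Ss se] := cross_adh x z e20; have [t St te] := cross_adh y z e20.
have := metric_triangle x s y; have := metric_triangle s t y.
have := metric_triangle (phi s) z (phi t); rewrite (phi_isom Ss St).
rewrite (metric_sym z) (metric_sym t); lra.
Qed.

Let cross_rlr x z w : mdist z w <= cross x z + cross x w.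
Proof.
apply/ler_addgt0Pr => e e0; have e20 : 0 < e / 2 by lra.
have [s Ss se] := cross_adh x z e20; have [t St te] := cross_adh x w e20.
have := metric_triangle z (phi s) w; have := metric_triangle (phi s) (phi t) w.
have := metric_triangle s x t; rewrite (phi_isom Ss St).
rewrite (metric_sym z (phi s)) (metric_sym s x); lra.
Qed.

Let glue_dist_triangle v u w : glue_dist u w <= glue_dist u v + glue_dist v w.
Proof.
case: u v w => x [] y [] z /=; try exact: metric_triangle.
- exact: cross_l.
- exact: cross_lrl.
- exact: cross_r.
- by rewrite addrC (metric_sym y); exact: cross_l.
- exact: cross_rlr.
- by rewrite addrC (metric_sym x); exact: cross_r.
Qed.

Definition glue_pseudometric : pseudometric R glue :=
  Pseudometric glue_distxx glue_distC glue_dist_triangle.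

Lemma glue_embed : separable_space X -> separable_space Z ->
  exists W : pmetricType R, exists i : X -> W, exists j : Z -> W,
  [/\ separable_space W, isometric i, isometric j & forall s, S s -> i s = j (phi s)].
Proof.
move=> [D cD dD] [E cE dE].
pose i (x : X) : mquot glue_pseudometric := mquot_pi _ (inl x : glue).
pose j (z : Z) : mquot glue_pseudometric := mquot_pi _ (inr z : glue).
exists (mquot glue_pseudometric), i, j; split.
- exists (\bigcup_b (if b then i @` D else j @` E)).
    apply: bigcup_countable => //= -[] _.
      exact: card_le_trans (card_image_le _ _) cD.
    exact: card_le_trans (card_image_le _ _) cE.
  move=> O [u Ou] oO.
  have /nbhs_ballP[e /= e0 eO] := open_nbhs_nbhs (conj oO Ou).
  have [[x|z] uE] := mquot_piK u; subst u.
    have [c Dc xc] := mdist_closer x dD e0.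
    exists (i c); split; last by exists true => //; exists c.
    by apply: eO; rewrite ballEmdist/= mdist_mquot_pi.
  have [c Dc xc] := mdist_closer z dE e0.
  exists (j c); split; last by exists false => //; exists c.
  by apply: eO; rewrite ballEmdist/= mdist_mquot_pi.
- by move=> x y; rewrite mdist_mquot_pi.
- by move=> x y; rewrite mdist_mquot_pi.
- move=> s Ss; apply: mdist_positivity; rewrite mdist_mquot_pi /=.
  apply/le_anti/andP; split.
    by have := cross_le s (phi s) Ss; rewrite !mdistxx addr0.
  by apply: lb_le_inf; [exact: (has_inf_cross _ _).1|
    move=> _ [t _ <-]; rewrite addr_ge0// mdist_ge0].
Qed.
End gluing.

Section mm_support.
Context {R : realType} (X : mmSpace R).

Lemma negligible_setC_mm_support :
  (mm_measure X).-negligible (~` (@mm_support R X) : set (borel X)).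
Proof.
have [D cD dD] := mm_separable X.
pose F (i : X * nat) : set (borel X) := (ball i.1 (i.2.+1%:R^-1 : R))^°.
pose P := [set i : X * nat | D i.1 /\ mm_measure X (F i) = 0%E].
have cP : countable P.
  apply: (@sub_countable _ _ _ (D `*` [set: nat])); last exact: countableX.
  by apply: subset_card_le => i [Di _].
have nF i : P i -> (mm_measure X).-negligible (F i).
  move=> [_ F0]; apply/negligibleP => //.
  by apply: sub_sigma_algebra; exact: open_interior.
have : (mm_measure X).-negligible (\bigcup_(i in P) F i).
  move/pfcard_geP : cP => [->|[g]].
    by rewrite bigcup_set0; exact: negligible_set0.
  rewrite -(image_eq g).
  by rewrite bigcup_image; apply: negligible_bigcup => n; apply/nF/funS.
apply: negligibleS => x /existsNP[U /not_implyP[oU /not_implyP[Ux /negP]]].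
rewrite -leNgt => U0.
have /nbhs_ballP[e /= e0 eU] := open_nbhs_nbhs (conj oU Ux).
have [n] : exists n : nat, n.+1%:R^-1 < e / 2 :> R.
  have /ltr_add_invr[n] : 0 < e / 2 by lra.
  by rewrite add0r; exists n.
have : 0 < n.+1%:R^-1 :> R by rewrite invr_gt0.
set r : R := n.+1%:R^-1 => r0 re.
have [c Dc xc] := mdist_closer x dD r0.
have crU : ball c r `<=` U.
  move=> y; rewrite ballEmdist/= => cy; apply: eU; rewrite ballEmdist/=.
  by have := metric_triangle x c y; lra.
exists (c, n); last first.
  apply/nbhs_ballP; exists (r - mdist x c); first by rewrite /= subr_gt0.
  move=> y; rewrite !ballEmdist/= => xy.
  by have := metric_triangle c x y; rewrite (metric_sym c x) -/r; lra.
split=> //=; apply/le_anti; rewrite measure_ge0 andbT.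
apply: le_trans U0; apply: le_measure; rewrite ?inE.
- by apply: sub_sigma_algebra; exact: open_interior.
- exact: sub_sigma_algebra.
- exact: subset_trans (@interior_subset _ _) crU.
Qed.
End mm_support.

Lemma measurable_open (X : ptopologicalType) (U : set X) :
  open U -> measurable (U : set (borel X)).
Proof. by move=> oU; exact: sub_sigma_algebra. Qed.

Lemma measurable_isometric (R : realType) (X Y : pmetricType R) (f : X -> Y) :
  isometric f -> measurable_fun [set: borel X] (f : borel X -> borel Y).
Proof.
move=> fI; have borelE : @measurable _ (borel Y) = <<s @open Y >> by [].
apply: (measurability _ borelE) => _ [U oU <-]; rewrite setTI.
suff : open (f @^-1` U : set X) by exact: measurable_open.
rewrite openE => x /= Ux.
have /nbhs_ballP[e /= e0 eU] := open_nbhs_nbhs (conj oU Ux).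
apply/nbhs_ballP; exists e => //= y; rewrite ballEmdist/= => xy.
by apply: eU; rewrite ballEmdist/= fI.
Qed.

Lemma measurable_preimage_isometric (R : realType) (X Y : pmetricType R)
    (f : X -> Y) (A : set (borel Y)) :
  isometric f -> measurable A -> measurable (f @^-1` A : set (borel X)).
Proof.
move=> /measurable_isometric mf mA.
by rewrite -[X in measurable X]setTI; exact: mf.
Qed.

Lemma enlargementP (R : realType) (X : metricType R) (A : set X) e x :
  enlargement A e x <-> exists2 a, A a & mdist a x < e.
Proof.
split=> [/ereal_inf_lt[_ [a Aa <-]]|[a Aa ae]]; first by rewrite lte_fin; exists a.
rewrite /enlargement/=; apply: le_lt_trans (_ : (mdist a x)%:E < _)%E => //.
by apply: ereal_inf_lbound; exists a.
Qed.

Lemma measurable_enlargement (R : realType) (X : pmetricType R) (A : set X) e :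
  measurable (enlargement A e : set (borel X)).
Proof.
suff : open (enlargement A e) by exact: measurable_open.
rewrite openE => x /enlargementP[a Aa ae].
apply/nbhs_ballP; exists (e - mdist a x); first by rewrite /= subr_gt0.
move=> y; rewrite ballEmdist/= => xy; apply/enlargementP; exists a => //.
by have := metric_triangle a x y; lra.
Qed.

Section invariance.
Context {R : realType}.
Implicit Types X Y : mmSpace R.
Local Open Scope ereal_scope.

Lemma mm_support_neq0 X : @mm_support R X !=set0.
Proof.
apply/set0P/negP => /eqP S0.
have [N [mN N0]] := negligible_setC_mm_support X.
rewrite S0 setC0 => /(_ _ _) TN.
have : mm_measure X [set: borel X] = 0.
  by apply/eqP; rewrite -measure_le0 -N0; apply: le_measure; rewrite ?inE.
by rewrite probability_setT => /eqP; rewrite onee_eq0.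
Qed.

Lemma le_measure_mm_support X (A B : set (borel X)) :
  measurable A -> measurable B ->
  A `&` @mm_support R X `<=` B -> mm_measure X A <= mm_measure X B.
Proof.
move=> mA mB AB; have [N [mN N0 SN]] := negligible_setC_mm_support X.
apply: (@le_trans _ _ (mm_measure X (B `|` N))).
  apply: le_measure; rewrite ?inE//; first exact: measurableU.
  move=> x Ax; have [Sx|Sx] := pselect (mm_support x); [left|right].
    exact: AB.
  exact: SN.
by rewrite (le_trans (measureU2 _ _ _))// [X in _ + X]N0 adde0.
Qed.

Lemma pushforward_mm_isomorphic X X1 (phi : borel X -> borel X1)
    (W : pmetricType R) (i : X -> W) (k : X1 -> W) (A : set (borel W)) :
  measurable_fun setT phi ->
  (forall B : set (borel X1), measurable B ->
     mm_measure X1 B = pushforward (mm_measure X) phi B) ->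
  isometric i -> isometric k ->
  (forall s, @mm_support R X s -> i s = k (phi s)) -> measurable A ->
  mm_measure X (i @^-1` A) = mm_measure X1 (k @^-1` A).
Proof.
move=> mphi pphi iI kI ik mA.
have mkA := measurable_preimage_isometric kI mA.
have miA := measurable_preimage_isometric iI mA.
rewrite pphi// /pushforward; have mphikA : measurable (phi @^-1` (k @^-1` A)).
  by rewrite -[X in measurable X]setTI; exact: mphi.
apply/le_anti/andP; split; apply: le_measure_mm_support => // x [].
  by move=> /= + Sx; rewrite ik.
by move=> /= + Sx; rewrite ik.
Qed.

Lemma isometric_comp (X Y Z : metricType R) (f : X -> Y) (g : Y -> Z) :
  isometric f -> isometric g -> isometric (g \o f).
Proof. by move=> fI gI x y; rewrite /= gI fI. Qed.

Lemma mm_isomorphic_glue X X1 (Z : pmetricType R) (f : X1 -> Z) :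
  mm_isomorphic X X1 -> separable_space Z -> isometric f ->
  exists W : pmetricType R, exists i : X -> W, exists j : Z -> W,
  [/\ separable_space W, isometric i, isometric j &
    forall A : set (borel W), measurable A ->
      mm_measure X (i @^-1` A) = mm_measure X1 (f @^-1` (j @^-1` A))].
Proof.
move=> [phi [mphi pphi phiI]] sZ fI.
have fphiI (x y : X) : mm_support x -> mm_support y ->
    mdist (f (phi x)) (f (phi y)) = mdist x y.
  by move=> Sx Sy; rewrite fI; exact: phiI.
have [W [i [j [sW iI jI ij]]]] :=
  @glue_embed R X Z _ (f \o phi) fphiI (mm_support_neq0 X) (mm_separable X) sZ.
exists W, i, j; split => // A mA.
apply: (pushforward_mm_isomorphic mphi pphi iI (isometric_comp fI jI)) => //.
Qed.

Lemma preimage_enlargement (Z W : pmetricType R) (j : Z -> W) (A : set W) e :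
  isometric j -> enlargement (j @^-1` A) e `<=` j @^-1` enlargement A e.
Proof.
move=> jI z /enlargementP[a /= Aa az]; apply/enlargementP.
by exists (j a) => //; rewrite jI.
Qed.

Lemma mm_gromov_prohorov_isol X X1 Y : mm_isomorphic X X1 ->
  mm_gromov_prohorov X Y <= mm_gromov_prohorov X1 Y.
Proof.
move=> XX1; apply: le_ereal_inf_tmp => _ [Z [f [g [sZ fI gI ->]]]].
have [W [i [j [sW iI jI ijE]]]] := mm_isomorphic_glue XX1 sZ fI.
apply: le_trans (_ : prohorov (pushforward (mm_measure X) (i : borel X -> borel W))
  (pushforward (mm_measure Y) (j \o g : borel Y -> borel W)) <= _).
  apply: ereal_inf_lbound; exists W, i, (j \o g); split=> //.
  exact: isometric_comp.
apply: ereal_inf_le_tmp => _ [e [e0 He] <-]; exists e => //; split=> // A mA.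
rewrite /pushforward ijE//.
apply: le_trans (He _ (measurable_preimage_isometric jI mA)) _.
rewrite leeD2r//; apply: (@le_measure _ _ _ (mm_measure Y)); rewrite ?inE.
- exact: measurable_preimage_isometric gI (measurable_enlargement _ _).
- apply: measurable_preimage_isometric (measurable_enlargement _ _).
  exact: isometric_comp.
- by move=> y; exact: preimage_enlargement.
Qed.

Lemma mm_gromov_prohorov_isor X Y Y1 : mm_isomorphic Y Y1 ->
  mm_gromov_prohorov X Y <= mm_gromov_prohorov X Y1.
Proof.
move=> YY1; apply: le_ereal_inf_tmp => _ [Z [f [g [sZ fI gI ->]]]].
have [W [i [j [sW iI jI ijE]]]] := mm_isomorphic_glue YY1 sZ gI.
apply: le_trans (_ : prohorov
  (pushforward (mm_measure X) (j \o f : borel X -> borel W))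
  (pushforward (mm_measure Y) (i : borel Y -> borel W)) <= _).
  apply: ereal_inf_lbound; exists W, (j \o f), i; split=> //.
  exact: isometric_comp.
apply: ereal_inf_le_tmp => _ [e [e0 He] <-]; exists e => //; split=> // A mA.
apply: le_trans (He _ (measurable_preimage_isometric jI mA)) _.
rewrite leeD2r// [leRHS]/pushforward ijE; last exact: measurable_enlargement.
apply: (@le_measure _ _ _ (mm_measure Y1)); rewrite ?inE.
- exact: measurable_preimage_isometric gI (measurable_enlargement _ _).
- apply: measurable_preimage_isometric gI _.
  exact: measurable_preimage_isometric jI (measurable_enlargement _ _).
- by move=> y; exact: preimage_enlargement.
Qed.

Lemma mm_isomorphic_refl X : mm_isomorphic X X.
Proof. by exists id. Qed.

Lemma gromov_prohorov_class X Y :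
  gromov_prohorov (mm_class X) (mm_class Y) = mm_gromov_prohorov X Y.
Proof.
apply/le_anti/andP; split.
  apply: ereal_inf_lbound; exists X, Y; split => //; exact: mm_isomorphic_refl.
apply: le_ereal_inf_tmp => _ [X1 [Y1 [XX1 YY1 ->]]].
exact: le_trans (mm_gromov_prohorov_isol _ XX1) (mm_gromov_prohorov_isor _ YY1).
Qed.

End invariance.

Definition metric_continuous (R : realType) (S T : Type) (dS : S -> S -> \bar R)
    (dT : T -> T -> \bar R) (f : S -> T) : Prop :=
  forall x (e : R), 0 < e -> exists2 delta : R, 0 < delta &
    forall y, (dS x y < delta%:E)%E -> (dT (f x) (f y) < e%:E)%E.

(* Main.v *)
Require Import Defs.
From mathcomp Require Import all_boot all_order all_algebra.
From mathcomp Require Import all_classical all_reals all_analysis.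
From mathcomp Require Import measurable_realfun lra.
Set Implicit Arguments.
Unset Strict Implicit.
Unset Printing Implicit Defensive.
Import Order.TTheory GRing.Theory Num.Theory.
Import numFieldNormedType.Exports.
Local Open Scope classical_set_scope.
Local Open Scope ring_scope.

(** Fix [h].  The coded spaces of [h] and [h'] are both parametrised by the same
probability space, the unit interval with Lebesgue measure.  So they are
Gromov-Prohorov close as soon as the pseudometrics [exc_dist h] and
[exc_dist h'] are uniformly close off a set of small measure: gluing the two
spaces along the parametrisation, with a little slack, makes the two images of a
typical parameter close to each other ([slack_glue]), and two random points on
one probability space that are close with high probability have close laws
([prohorov_coupling]).  [coded_gromov_prohorov_le] combines the two.

The pseudometrics differ in the values at the two endpoints and in the infima.
Closeness in [exc_dist_leb] bounds the first difference off a small set.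
Closeness of the epigraphs says that each value of one function is almost
reached, from above, by the other function at a nearby point.  This compares the
infima over [s, t], unless the nearby point falls outside [s, t]; then an
endpoint lies close to both points, and the comparison is restored if the
endpoint [s] is such that [h] drops little below [h s] near [s]
([exc_dist_distortion]).  By lower semicontinuity every [s] has this property at
some scale, so by continuity of measure most [s] have it at one common scale
([drop_near_lebesgue01_small]).  That scale depends on [h] only, so only [h], and
never [h'], has to be controlled near the endpoints; this is why continuity at
[h] results, without any uniformity in [h]. *)

(** * Gluing two metric spaces along an almost isometric correspondence *)

(** If [f i] and [g i] are put at distance [c], the triangle inequality forces
the distances of [X] and of [Y] to differ by at most [2 * c] along the
correspondence.  The section shows that this is the only obstruction: the
shortest-path distance through the pairs [(f i, g i)] then restricts to the
given ones. *)
Section slack_gluing.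
Context {R : realType} (X Y : pmetricType R) (I : Type).
Context (f : I -> X) (g : I -> Y) (S : set I) (c : R).
Context (S0 : S !=set0) (c0 : 0 <= c).
Context (distortion : forall i j, S i -> S j ->
  `|mdist (f i) (f j) - mdist (g i) (g j)| <= 2 * c).
Implicit Types e : R.

Let cross_set x y := [set mdist x (f i) + c + mdist (g i) y | i in S].
Let cross x y := inf (cross_set x y).

Let has_inf_cross x y : has_inf (cross_set x y).
Proof.
have [i Si] := S0; split; first by exists (mdist x (f i) + c + mdist (g i) y), i.
by exists 0 => _ [j _ <-]; rewrite !addr_ge0// mdist_ge0.
Qed.

Let cross_le x y i : S i -> cross x y <= mdist x (f i) + c + mdist (g i) y.
Proof. by move=> Si; apply: ge_inf; [exact: (has_inf_cross x y).2|exists i]. Qed.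

Let cross_adh x y e : 0 < e ->
  exists2 i, S i & mdist x (f i) + c + mdist (g i) y < cross x y + e.
Proof.
move=> e0; have [_ [i Si <-] ?] := inf_adherent e0 (has_inf_cross x y).
by exists i.
Qed.

Definition slack_dist (u v : Defs.glue X Y) : R :=
  match u, v with
  | inl x, inl y => mdist x y
  | inr z, inr w => mdist z w
  | inl x, inr z | inr z, inl x => cross x z
  end.

Let slack_distxx u : slack_dist u u = 0.
Proof. by case: u => x; exact: mdistxx. Qed.

Let slack_distC u v : slack_dist u v = slack_dist v u.
Proof. by case: u v => x [] y //=; exact: metric_sym. Qed.

Let cross_l x y z : cross x z <= mdist x y + cross y z.
Proof.
apply/ler_addgt0Pr => e /(cross_adh y z)[i Si ie].
have := cross_le x z Si; have := metric_triangle x y (f i); lra.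
Qed.

Let cross_r x z w : cross x w <= cross x z + mdist z w.
Proof.
apply/ler_addgt0Pr => e /(cross_adh x z)[i Si ie].
have := cross_le x w Si; have := metric_triangle (g i) z w; lra.
Qed.

Let cross_lrl x y z : mdist x y <= cross x z + cross y z.
Proof.
apply/ler_addgt0Pr => e e0; have e20 : 0 < e / 2 by lra.
have [i Si ie] := cross_adh x z e20; have [j Sj je] := cross_adh y z e20.
have := metric_triangle x (f i) y; have := metric_triangle (f i) (f j) y.
have := metric_triangle (g i) z (g j).
have := distortion Si Sj; rewrite ler_distl => /andP[_].
rewrite (metric_sym z) (metric_sym (f j)); lra.
Qed.

Let cross_rlr x z w : mdist z w <= cross x z + cross x w.
Proof.
apply/ler_addgt0Pr => e e0; have e20 : 0 < e / 2 by lra.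
have [i Si ie] := cross_adh x z e20; have [j Sj je] := cross_adh x w e20.
have := metric_triangle z (g i) w; have := metric_triangle (g i) (g j) w.
have := metric_triangle (f i) x (f j).
have := distortion Si Sj; rewrite ler_distl => /andP[+ _].
rewrite (metric_sym z (g i)) (metric_sym (f i) x); lra.
Qed.

Let slack_dist_triangle v u w :
  slack_dist u w <= slack_dist u v + slack_dist v w.
Proof.
case: u v w => x [] y [] z /=; try exact: metric_triangle.
- exact: cross_l.
- exact: cross_lrl.
- exact: cross_r.
- by rewrite addrC (metric_sym y); exact: cross_l.
- exact: cross_rlr.
- by rewrite addrC (metric_sym x); exact: cross_r.
Qed.

Definition slack_pseudometric : pseudometric R (Defs.glue X Y) :=
  Pseudometric slack_distxx slack_distC slack_dist_triangle.

Lemma slack_glue : separable_space X -> separable_space Y ->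
  exists W : pmetricType R, exists i : X -> W, exists j : Y -> W,
  [/\ separable_space W, isometric i, isometric j &
    forall k, S k -> mdist (i (f k)) (j (g k)) <= c].
Proof.
move=> [D cD dD] [E cE dE].
pose i (x : X) : mquot slack_pseudometric := mquot_pi _ (inl x : Defs.glue X Y).
pose j (y : Y) : mquot slack_pseudometric := mquot_pi _ (inr y : Defs.glue X Y).
exists (mquot slack_pseudometric), i, j; split.
- exists (\bigcup_b (if b then i @` D else j @` E)).
    apply: bigcup_countable => //= -[] _.
      exact: card_le_trans (card_image_le _ _) cD.
    exact: card_le_trans (card_image_le _ _) cE.
  move=> O [u Ou] oO.
  have /nbhs_ballP[e /= e0 eO] := open_nbhs_nbhs (conj oO Ou).
  have [[x|y] uE] := mquot_piK u; subst u.
    have [a Da xa] := mdist_closer x dD e0.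
    exists (i a); split; last by exists true => //; exists a.
    by apply: eO; rewrite ballEmdist/= mdist_mquot_pi.
  have [a Ea ya] := mdist_closer y dE e0.
  exists (j a); split; last by exists false => //; exists a.
  by apply: eO; rewrite ballEmdist/= mdist_mquot_pi.
- by move=> x y; rewrite mdist_mquot_pi.
- by move=> x y; rewrite mdist_mquot_pi.
- move=> k Sk; rewrite mdist_mquot_pi /=.
  by have := cross_le (f k) (g k) Sk; rewrite !mdistxx addr0 add0r.
Qed.

End slack_gluing.

(** * From couplings to the Gromov-Prohorov distance *)

(** This is the easy half of Strassen's theorem: where [g t] is not in the
enlargement of a set that contains [f t], the exceptional event [B] occurs. *)
Lemma prohorov_coupling (R : realType) d (T : measurableType d)
    (P : {measure set T -> \bar R}) (Z : pmetricType R) (f g : T -> borel Z)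
    (B : set T) (e : R) :
  measurable_fun setT f -> measurable_fun setT g -> measurable B -> 0 < e ->
  (P B <= e%:E)%E -> (forall t, ~ B t -> mdist (f t : Z) (g t) < e) ->
  (prohorov (pushforward P f) (pushforward P g) <= e%:E)%E.
Proof.
move=> mf mg mB e0 PB fg; apply: ereal_inf_lbound; exists e => //; split=> // A mA.
rewrite /pushforward.
have mfA : measurable (f @^-1` A) by rewrite -[X in measurable X]setTI; exact: mf.
have mgA : measurable (g @^-1` (enlargement A e : set (borel Z))).
  rewrite -[X in measurable X]setTI; apply: mg => //.
  exact: measurable_enlargement.
apply: (@le_trans _ _ (P (g @^-1` (enlargement A e) `|` B))).
  apply: le_measure; rewrite ?inE//; first exact: measurableU.
  move=> t At; have [Bt|nBt] := pselect (B t); [by right|left].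
  by apply/enlargementP; exists (f t) => //; exact: fg.
by rewrite (le_trans (measureU2 _ _ _))// leeD2l.
Qed.

(** The two coding maps form a coupling of the coded measures, driven by Lebesgue
measure; the bound [e < 1] guarantees that there is a parameter outside [B] to
glue along. *)
Lemma coded_gromov_prohorov_le (R : realType) (h h' : excursion R)
    (B : set (borel (unitI R))) (c e : R) :
  measurable B -> 0 <= c -> c < e -> e < 1 -> (lebesgue01 B <= e%:E)%E ->
  (forall s t, ~ B s -> ~ B t ->
     `|exc_dist h s t - exc_dist h' s t| <= 2 * c) ->
  (mm_gromov_prohorov (coded_mmSpace h) (coded_mmSpace h') <= e%:E)%E.
Proof.
move=> mB c0 ce e1 Be dist.
have S0 : ~` B !=set0.
  apply/set0P/negP => /eqP/(congr1 setC); rewrite setCK setC0 => BT.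
  move: Be; rewrite BT probability_setT lee_fin => ?; lra.
have dist' (s t : borel (unitI R)) : (~` B) s -> (~` B) t ->
    `|mdist (coding_map h s : completion (coded_space h)) (coding_map h t)
     - mdist (coding_map h' s : completion (coded_space h')) (coding_map h' t)|
    <= 2 * c.
  move=> Bs Bt; rewrite /coding_map !to_completion_isometric.
  by rewrite [mdist _ _]mdist_coded_pi [X in _ - X]mdist_coded_pi; exact: dist.
have [W [i [j [sW iI jI ij]]]] := slack_glue S0 c0 dist'
  (mm_separable (coded_mmSpace h)) (mm_separable (coded_mmSpace h')).
apply: (@le_trans _ _ (prohorov
    (pushforward (mm_measure (coded_mmSpace h)) (i : borel _ -> borel W))
    (pushforward (mm_measure (coded_mmSpace h')) (j : borel _ -> borel W)))).
  by apply: ereal_inf_lbound; exists W, i, j.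
apply: (@prohorov_coupling R _ _ (@lebesgue01 R) W (i \o coding_map h)
  (j \o coding_map h') B) => //.
- exact: measurableT_comp (measurable_isometric iI) (@measurable_coding_map R h).
- exact: measurableT_comp (measurable_isometric jI) (@measurable_coding_map R h').
- by lra.
- by move=> t Bt; exact: le_lt_trans (ij t Bt) ce.
Qed.

(** * Distortion of the tree metric *)

Section oscillation.
Context {R : realType}.
Implicit Types (h : excursion R) (s t u v : unitI R) (a r : R).

(** The bad endpoints: moving one of them by less than [r] may lower the infimum
of [h] over an interval by more than [a]. *)
Definition drop_near h a r : set (unitI R) :=
  [set s | exists2 u, `|unitI_val s - unitI_val u| < r & h u + a < h s].

Lemma open_exc_gt h a : open [set s | a < h s].
Proof.
rewrite (_ : mkset _ = [set s | (a%:E < (EFin \o h) s)%E]).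
  by move: a; apply/lower_semicontinuousP; exact: exc_lsc.
by apply/seteqP; split=> s /=; rewrite lte_fin.
Qed.

(** For a fixed witness [u] both conditions on [s] are open, the second one by
lower semicontinuity; so measurability comes without any countable union. *)
Lemma open_drop_near h a r : open (drop_near h a r).
Proof.
rewrite (_ : drop_near h a r = \bigcup_u
    ([set s | `|unitI_val s - unitI_val u| < r] `&` [set s | h u + a < h s])).
  apply: bigcup_open => u _; apply: openI; last exact: open_exc_gt.
  rewrite (_ : mkset _ = unitI_val @^-1` ball (unitI_val u) r).
    by move/continuousP : (@unitI_val_continuous R); apply; exact: ball_open.
  by apply/seteqP; split=> s; rewrite /ball/= distrC.
apply/seteqP; split=> [s [u su us]|s [u _ [su us]]]; first by exists u.
by exists u.
Qed.

(** Lower semicontinuity at [s] says that [s] leaves [drop_near h a r] for small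
[r]; these sets decrease to the empty set with [r]. *)
Lemma drop_near_lebesgue01_small h a (e : R) : 0 < a -> 0 < e ->
  exists2 r, 0 < r & (lebesgue01 (drop_near h a r) < e%:E)%E.
Proof.
move=> a0 e0; pose F (n : nat) : set (borel (unitI R)) := drop_near h a n.+1%:R^-1.
have mF n : measurable (F n).
  by apply: (@measurable_open (unitI R)); exact: open_drop_near.
have F0 : \bigcap_n F n = set0.
  apply/seteqP; split=> // s Fs.
  have : nbhs s [set u | h s - a < h u].
    by apply: open_nbhs_nbhs; split; [exact: open_exc_gt|rewrite /=; lra].
  move=> [_ [[V oV <-] /= Vs VU]].
  have /nbhs_ballP[d /= d0 dV] := open_nbhs_nbhs (conj oV Vs).
  have [n] : exists n : nat, n.+1%:R^-1 < d :> R.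
    by have /ltr_add_invr[n] := d0; rewrite add0r; exists n.
  move=> nd; have [u su us] := Fs n I.
  have : h s - a < h u by apply: VU; apply: dV; exact: lt_trans nd.
  lra.
have : lebesgue01 \o F @ \oo --> lebesgue01 (\bigcap_n F n).
  apply: nonincreasing_cvg_mu => //.
  - by rewrite (le_lt_trans (probability_le1 _ _))// ltry.
  - by rewrite F0.
  - move=> m n mn; apply/subsetPset => s [u su us]; exists u => //.
    by apply: lt_le_trans su _; rewrite lef_pV2 ?posrE// ler_nat.
rewrite F0 measure0 => /(_ [set x | (x < e%:E)%E]) [].
  by apply: open_nbhs_nbhs; split; [exact: open_ereal_lt_ereal|rewrite /= lte_fin].
move=> n _ /(_ n (leqnn n)) /= Fn.
by exists n.+1%:R^-1.
Qed.

(** A step of length less than [r] that leaves an interval passes over one of its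
endpoints, which is thus within [r] of both ends of the step. *)
Lemma between_exit s t u v r : between s t u -> ~ between s t v ->
  `|unitI_val u - unitI_val v| < r ->
  exists2 w, w = s \/ w = t &
    `|unitI_val w - unitI_val u| < r /\ `|unitI_val w - unitI_val v| < r.
Proof.
rewrite /between/= => /andP[]; rewrite ge_min le_max => su ut /negP.
rewrite negb_and -!ltNge lt_min gt_max !ltr_distl => + /andP[? ?].
move=> /orP[/andP[? ?]|/andP[? ?]].
- case/orP: su => ?; [exists s; first by left|exists t; first by right];
    by rewrite !ltr_distl; split; apply/andP; split; lra.
- case/orP: ut => ?; [exists s; first by left|exists t; first by right];
    by rewrite !ltr_distl; split; apply/andP; split; lra.
Qed.

(** The infima differ by at most [a + r] because each value of one function over
the interval is matched, up to [r], by a value of the other at a point [v].  If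
[v] is outside the interval, an endpoint [w] takes its place: the value
[h w] exceeds [h] at any point within [r] of [w] by at most [a].  This is used
at the original point to bound the infimum of [h'], and at [v] to bound the
infimum of [h], so that it is only ever needed for [h]. *)
Lemma exc_dist_distortion h h' a r s t :
  ~ drop_near h a r s -> ~ drop_near h a r t -> 0 <= a ->
  `|h s - h' s| <= r -> `|h t - h' t| <= r ->
  (forall u, exists2 v, `|unitI_val u - unitI_val v| < r & h' v <= h u + r) ->
  (forall u, exists2 v, `|unitI_val u - unitI_val v| < r & h v <= h' u + r) ->
  `|exc_dist h s t - exc_dist h' s t| <= 2 * (a + 2 * r).
Proof.
move=> ns nt a0 hs ht hh' h'h.
have drop w u : w = s \/ w = t -> `|unitI_val w - unitI_val u| < r ->
    h w <= h u + a.
  by move=> wE wu; rewrite leNgt; apply/negP => ?; case: wE => ?; subst w;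
    [apply: ns|apply: nt]; exists u.
have btw w k : w = s \/ w = t -> exc_inf k s t <= k w.
  by move=> [] ->; apply: exc_inf_le; [exact: between_left|exact: between_right].
have Ile : exc_inf h' s t - (a + r) <= exc_inf h s t.
  apply: exc_inf_ge => u stu; have [v uv h'v] := hh' u.
  have [stv|nstv] := pselect (between s t v).
    by have := exc_inf_le h' stv; lra.
  have [w wE [wu wv]] := between_exit stu nstv uv.
  have := drop w u wE wu; have := btw w h' wE.
  by move: hs ht; rewrite !ler_distl => /andP[? ?] /andP[? ?]; case: wE => ->; lra.
have Ige : exc_inf h s t - (a + r) <= exc_inf h' s t.
  apply: exc_inf_ge => u stu; have [v uv hv] := h'h u.
  have [stv|nstv] := pselect (between s t v).
    by have := exc_inf_le h stv; lra.
  have [w wE [wu wv]] := between_exit stu nstv uv.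
  by have := drop w v wE wv; have := btw w h wE; lra.
move: hs ht; rewrite /exc_dist !ler_distl => /andP[? ?] /andP[? ?].
by apply/andP; split; lra.
Qed.

End oscillation.

(** * What closeness in the excursion metric gives *)

Section excursion_metric_bounds.
Context {R : realType}.
Implicit Types (h : excursion R) (u v : unitI R) (r : R).

Lemma dist_to_epi_lt h h' r u :
  (dist_to_set (@euclid_dist R) (epi h') (unitI_val u, h u) < r%:E)%E ->
  exists2 v, `|unitI_val u - unitI_val v| < r & h' v <= h u + r.
Proof.
move=> /ereal_inf_lt[_ [[x y] [v /= vx h'y] <-]]; rewrite lte_fin /euclid_dist/=.
rewrite -vx => lt_r; exists v.
  apply: le_lt_trans lt_r; rewrite distrC -sqrtr_sqr ler_wsqrtr//.
  by rewrite lerDl sqr_ge0.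
have : `|y - h u| < r.
  apply: le_lt_trans lt_r; rewrite -sqrtr_sqr ler_wsqrtr//.
  by rewrite lerDr sqr_ge0.
by rewrite ltr_distl => /andP[_]; lra.
Qed.

Lemma exc_dist_epi_lt h h' r : (exc_dist_epi h h' < r%:E)%E ->
  (forall u, exists2 v, `|unitI_val u - unitI_val v| < r & h' v <= h u + r) /\
  (forall u, exists2 v, `|unitI_val u - unitI_val v| < r & h v <= h' u + r).
Proof.
rewrite /exc_dist_epi /hausdorff_dist gt_max => /andP[lt1 lt2]; split=> u.
- apply: dist_to_epi_lt; apply: le_lt_trans lt1.
  by apply: ereal_sup_ubound; exists (unitI_val u, h u) => //; exists u.
- apply: dist_to_epi_lt; apply: le_lt_trans lt2.
  by apply: ereal_sup_ubound; exists (unitI_val u, h' u) => //; exists u.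
Qed.

Lemma exc_dist_epi_ge0 h h' : (0 <= exc_dist_epi h h')%E.
Proof.
rewrite /exc_dist_epi /hausdorff_dist le_max; apply/orP; left.
apply: (@le_trans _ _ (dist_to_set (@euclid_dist R) (epi h') (0, h unitI0))).
  by apply: le_ereal_inf_tmp => _ [p _ <-]; rewrite lee_fin sqrtr_ge0.
by apply: ereal_sup_ubound; exists (0, h unitI0) => //; exists unitI0.
Qed.

Lemma exc_dist_leb_ge0 h h' : (0 <= exc_dist_leb h h')%E.
Proof.
by apply: le_ereal_inf_tmp => _ [e [e0 _] <-]; rewrite lee_fin ltW.
Qed.

Lemma measurable_exc_far h h' r :
  measurable [set t : borel (unitI R) | r < `|h t - h' t|].
Proof.
rewrite (_ : mkset _ = (fun t : borel (unitI R) => `|h t - h' t|) @^-1` `]r, +oo[).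
  rewrite -[X in measurable X]setTI.
  have : measurable_fun [set: borel (unitI R)]
      (fun t : borel (unitI R) => `|h t - h' t| : measurableTypeR R).
    apply: measurableT_comp; first exact: normr_measurable.
    by apply: measurable_funB; exact: measurable_exc.
  by apply.
by apply/seteqP; split=> t /=; rewrite in_itv/= andbT.
Qed.

Lemma exc_dist_leb_lt h h' r : (exc_dist_leb h h' < r%:E)%E ->
  (lebesgue01 [set t : unitI R | r < `|h t - h' t|]%R < r%:E)%E.
Proof.
move=> /ereal_inf_lt[_ [e [e0 lt_e] <-]]; rewrite lte_fin => er.
apply: (@lt_trans _ _ e%:E); last by rewrite lte_fin.
apply: le_lt_trans lt_e; apply: le_measure; rewrite ?inE;
  try exact: measurable_exc_far.
by move=> t /=; exact: lt_trans.
Qed.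

End excursion_metric_bounds.

(** * Continuity of the coding *)

Theorem theorem4p8 (R : realType) :
  metric_continuous (@exc_metric R) (@gromov_prohorov R) (@coding R).
Proof.
move=> h e0 e0_gt0.
pose e := Num.min e0 (1 / 2).
have e_gt0 : 0 < e by rewrite lt_min e0_gt0 /=; lra.
have e_le : e <= e0 by rewrite ge_min lexx.
have e_lt1 : e < 1 by rewrite gt_min; apply/orP; right; lra.
(* The Prohorov bound will be [3 / 4 * e]: with [d] at most [e / 16], it exceeds
   both the slack [e / 4 + 2 * d] of the gluing and the measure [e / 4 + d] of
   the exceptional parameters. *)
have a_gt0 : 0 < e / 4 by lra.
have [r r_gt0 drop_lt] := drop_near_lebesgue01_small h a_gt0 a_gt0.
pose d := Num.min r (e / 16).
have d_gt0 : 0 < d by rewrite lt_min r_gt0 /=; lra.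
have d_le : d <= e / 16 by rewrite ge_min lexx orbT.
have d_ler : d <= r by rewrite ge_min lexx.
exists d => // h' hh'.
have epi_lt : (exc_dist_epi h h' < d%:E)%E.
  by apply: le_lt_trans hh'; rewrite leeDl// exc_dist_leb_ge0.
have leb_lt : (exc_dist_leb h h' < d%:E)%E.
  by apply: le_lt_trans hh'; rewrite leeDr// exc_dist_epi_ge0.
have [hh h'h] := exc_dist_epi_lt epi_lt.
rewrite gromov_prohorov_class; apply: (@le_lt_trans _ _ (3 / 4 * e)%:E); last first.
  by rewrite lte_fin; lra.
pose drops : set (borel (unitI R)) := drop_near h (e / 4) d.
pose far : set (borel (unitI R)) := [set t | d < `|h t - h' t|].
have m_drop q : measurable (drop_near h (e / 4) q : set (borel (unitI R))).
  by apply: measurable_open; exact: open_drop_near.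
have m_far : measurable far by exact: measurable_exc_far.
apply: (@coded_gromov_prohorov_le R h h' (drops `|` far) (e / 4 + 2 * d)).
- exact: measurableU (m_drop _) m_far.
- lra.
- lra.
- lra.
- apply: le_trans (measureU2 _ (m_drop _) m_far) _.
  apply: (@le_trans _ _ ((e / 4)%:E + d%:E)%E); last by rewrite -EFinD lee_fin; lra.
  apply: leeD; last exact/ltW/exc_dist_leb_lt.
  apply: le_trans (ltW drop_lt); apply: le_measure; rewrite ?inE//.
  by move=> s [u su us]; exists u => //; exact: lt_le_trans su d_ler.
- move=> s t /not_orP[ns fs] /not_orP[nt ft].
  apply: exc_dist_distortion => //; first exact: ltW.
  + by rewrite leNgt; apply/negP.
  + by rewrite leNgt; apply/negP.
Qed.
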